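(* Let $\mathbb{C}$ be a small coconfluent category and let $P$ be an atomic sheaf on $\mathbb{C}$. For each object $X$ of $\mathbb{C}$ define $$\sim_P(X) := \{(x,x') \in P(X)\times P(X) \mid \exists Z\ \exists u,u' \colon Z \to X \text{ in } \mathbb{C}.\ x\cdot u = x'\cdot u'\}.$$ Then: (i) for every morphism $f\colon Y\to X$ in $\mathbb{C}$ and every $(x,x')\in \sim_P(X)$ we have $(x\cdot f, x'\cdot f)\in \sim_P(Y)$; (ii) for every morphism $f\colon Y \to X$ and every $(x,x')\in P(X)\times P(X)$, if $(x\cdot f,x'\cdot f)\in\sim_P(Y)$ then $(x,x')\in\sim_P(X)$; so $\sim_P$ is a subsheaf of $P\times P$. Moreover (iii) for every object $X$, $\sim_P(X)$ is an equivalence relation on $P(X)$.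
   Context: A presheaf on a small category $\mathbb{C}$ is a functor $P\colon \mathbb{C}^{op}\to\mathbf{Set}$; for $f\colon Y\to X$ and $x\in P(X)$ write $x\cdot f := P(f)(x)\in P(Y)$. $\mathbb{C}$ is coconfluent if every cospan $X\xrightarrow{f} Z\xleftarrow{g} Y$ admits a span $X\xleftarrow{u} W\xrightarrow{v} Y$ with $f\circ u = g\circ v$. For $c\colon Y\to X$, an element $y\in P(Y)$ is $c$-invariant if $y\cdot d = y\cdot e$ for all $d,e\colon Z\to Y$ with $c\circ d = c\circ e$; an element $x\in P(X)$ is a $c$-descendent of $y$ if $y = x\cdot c$. $P$ is an atomic sheaf if for every $c\colon Y\to X$ every $c$-invariant $y\in P(Y)$ has a unique $c$-descendent. The product presheaf $P\times P$ is computed pointwise, $(x,x')\cdot f = (x\cdot f,x'\cdot f)$. For a sheaf $P$, a family of subsets $Q(X)\subseteq P(X)$ determines a subsheaf exactly when conditions of the form (i) (closure under restriction) and (ii) (reflection along restriction) hold. *)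

(* Defs.v *)
From Stdlib Require Import RelationClasses ProofIrrelevance.

Set Implicit Arguments.
Unset Strict Implicit.

Declare Scope cat_scope.
Open Scope cat_scope.

Record category := Category {
  obj :> Type;
  hom : obj -> obj -> Type;
  idm : forall X, hom X X;
  comp : forall X Y Z, hom Y Z -> hom X Y -> hom X Z;
  comp_idl : forall X Y (f : hom X Y), comp (idm Y) f = f;
  comp_idr : forall X Y (f : hom X Y), comp f (idm X) = f;
  comp_assoc : forall W X Y Z (h : hom Y Z) (g : hom X Y) (f : hom W X),
    comp h (comp g f) = comp (comp h g) f
}.
Arguments hom {c} X Y : rename.
Arguments idm {c} X.
Arguments comp {c X Y Z} g f : rename.
Notation "g ∘ f" := (comp g f) (at level 40, left associativity) : cat_scope.

Definition coconfluent (C : category) : Prop :=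
  forall (X Y Z : C) (f : hom X Z) (g : hom Y Z),
    exists (W : C) (u : hom W X) (v : hom W Y), f ∘ u = g ∘ v.

(* A functor from the opposite category of C to sets, with types under Leibniz
   equality as sets; [restr f x] is P(f)(x). *)
Record presheaf (C : category) := Presheaf {
  elt :> C -> Type;
  restr : forall X Y : C, hom Y X -> elt X -> elt Y;
  restr_id : forall (X : C) (x : elt X), restr (idm X) x = x;
  restr_comp : forall (X Y Z : C) (f : hom Y X) (g : hom Z Y) (x : elt X),
    restr (f ∘ g) x = restr g (restr f x)
}.
Arguments restr {C} p {X Y} f x.
Notation "x ⋅ f" := (restr _ f x) (at level 40, left associativity) : cat_scope.

Definition invariant (C : category) (P : presheaf C) (X Y : C) (c : hom Y X)
    (y : P Y) : Prop :=
  forall (Z : C) (d e : hom Z Y), c ∘ d = c ∘ e -> y ⋅ d = y ⋅ e.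

Definition descendent (C : category) (P : presheaf C) (X Y : C) (c : hom Y X)
    (y : P Y) (x : P X) : Prop :=
  y = x ⋅ c.

Definition atomic_sheaf (C : category) (P : presheaf C) : Prop :=
  forall (X Y : C) (c : hom Y X) (y : P Y),
    invariant c y -> exists! x : P X, descendent c y x.

Definition prod_presheaf (C : category) (P Q : presheaf C) : presheaf C.
Proof.
refine {| elt := fun X => (P X * Q X)%type;
          restr := fun X Y f p => (fst p ⋅ f, snd p ⋅ f) |}.
- intros X [x y]; simpl; now rewrite !restr_id.
- intros X Y Z f g [x y]; simpl; now rewrite !restr_comp.
Defined.

Definition restr_closed (C : category) (P : presheaf C)
    (Q : forall X : C, P X -> Prop) : Prop :=
  forall (X Y : C) (f : hom Y X) (x : P X), Q X x -> Q Y (x ⋅ f).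

Definition subpresheaf (C : category) (P : presheaf C)
    (Q : forall X : C, P X -> Prop) (HQ : restr_closed Q) : presheaf C.
Proof.
refine {| elt := fun X => {x : P X | Q X x};
          restr := fun X Y f x =>
            exist (Q Y) (proj1_sig x ⋅ f) (HQ X Y f _ (proj2_sig x)) |}.
- intros X [x qx]; apply subset_eq_compat; apply restr_id.
- intros X Y Z f g [x qx]; apply subset_eq_compat; apply restr_comp.
Defined.

(* The family of subsets Q, with the restriction maps inherited from P, is a
   presheaf that is itself an atomic sheaf. *)
Definition is_subsheaf (C : category) (P : presheaf C)
    (Q : forall X : C, P X -> Prop) : Prop :=
  exists HQ : restr_closed Q, atomic_sheaf (subpresheaf HQ).

Definition sim (C : category) (P : presheaf C) (X : C)
    (p : prod_presheaf P P X) : Prop :=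
  exists (Z : C) (u u' : hom Z X), fst p ⋅ u = snd p ⋅ u'.
Arguments sim {C} P X p.

(* Main.v *)
(* Extend the relation defining [sim] to elements over different objects. By
   coconfluence it is then an equivalence relation, and it relates every
   element to each of its restrictions, so closure under restriction is the
   chain x ⋅ f ~ x ~ x' ~ x' ⋅ f. *)

Require Import Defs.
From Stdlib Require Import RelationClasses ProofIrrelevance.

Definition restr_injective {C : category} (P : presheaf C) : Prop :=
  forall (X Y : C) (c : hom Y X) (x x' : P X), x ⋅ c = x' ⋅ c -> x = x'.

Definition restr_reflecting {C : category} {P : presheaf C}
    (Q : forall X : C, P X -> Prop) : Prop :=
  forall (X Y : C) (f : hom Y X) (x : P X), Q Y (x ⋅ f) -> Q X x.

Lemma invariant_restr {C : category} {P : presheaf C} {X Y : C} (c : hom Y X)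
    (x : P X) :
  invariant c (x ⋅ c).
Proof. intros Z d e Hde; now rewrite <- !restr_comp, Hde. Qed.

Lemma atomic_sheaf_iff {C : category} (P : presheaf C) :
  atomic_sheaf P <->
  restr_injective P /\
  (forall (X Y : C) (c : hom Y X) (y : P Y),
     invariant c y -> exists x : P X, descendent c y x).
Proof.
split.
- intros HP; split.
  + intros X Y c x x' Exx'.
    destruct (HP X Y c (x ⋅ c)) as [z [_ z_unique]];
      [apply invariant_restr|].
    now rewrite <- (z_unique x eq_refl), <- (z_unique x' Exx').
  + intros X Y c y Hy; destruct (HP X Y c y Hy) as [x [Hx _]]; now exists x.
- intros [Pinj Pdesc] X Y c y Hy; destruct (Pdesc X Y c y Hy) as [x Hx].
  exists x; split; [exact Hx|].
  intros x' Hx'; apply (Pinj X Y c); now rewrite <- Hx, <- Hx'.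
Qed.

Lemma invariant_prod {C : category} {P Q : presheaf C} {X Y : C} (c : hom Y X)
    (p : prod_presheaf P Q Y) :
  invariant c p <-> invariant c (fst p) /\ invariant c (snd p).
Proof.
split.
- intros Hp; split; intros Z d e Hde.
  + exact (f_equal fst (Hp Z d e Hde)).
  + exact (f_equal snd (Hp Z d e Hde)).
- intros [Hfst Hsnd] Z d e Hde.
  exact (f_equal2 pair (Hfst Z d e Hde) (Hsnd Z d e Hde)).
Qed.

Lemma prod_atomic_sheaf {C : category} (P Q : presheaf C) :
  atomic_sheaf P -> atomic_sheaf Q -> atomic_sheaf (prod_presheaf P Q).
Proof.
intros [Pinj Pdesc]%atomic_sheaf_iff [Qinj Qdesc]%atomic_sheaf_iff.
apply atomic_sheaf_iff; split.
- intros X Y c [x1 y1] [x2 y2] [= Ex Ey].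
  exact (f_equal2 pair (Pinj X Y c x1 x2 Ex) (Qinj X Y c y1 y2 Ey)).
- intros X Y c [y z] [Hy Hz]%invariant_prod.
  destruct (Pdesc X Y c y Hy) as [x Hx].
  destruct (Qdesc X Y c z Hz) as [w Hw].
  exists (x, w); exact (f_equal2 pair Hx Hw).
Qed.

Section Subsheaves.

Context {C : category} {P : presheaf C} {Q : forall X : C, P X -> Prop}.

Lemma subpresheaf_eq_iff (Qclosed : restr_closed Q) {X : C}
    (x x' : subpresheaf Qclosed X) :
  x = x' <-> proj1_sig x = proj1_sig x'.
Proof. apply eq_sig_hprop_iff; intros; apply proof_irrelevance. Qed.

Lemma invariant_subpresheaf (Qclosed : restr_closed Q) {X Y : C}
    (c : hom Y X) (y : subpresheaf Qclosed Y) :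
  invariant c y <-> invariant c (proj1_sig y).
Proof.
split; intros Hy Z d e Hde.
- exact (f_equal (@proj1_sig _ _) (Hy Z d e Hde)).
- apply subpresheaf_eq_iff; exact (Hy Z d e Hde).
Qed.

Lemma is_subsheaf_iff :
  atomic_sheaf P -> is_subsheaf Q <-> restr_closed Q /\ restr_reflecting Q.
Proof.
intros [Pinj Pdesc]%atomic_sheaf_iff; split.
- intros [Qclosed [_ Qdesc]%atomic_sheaf_iff]; split; [exact Qclosed|].
  intros X Y f x Qxf.
  destruct (Qdesc X Y f (exist _ (x ⋅ f) Qxf)) as [[z Qz] Hz].
  { apply invariant_subpresheaf, invariant_restr. }
  apply subpresheaf_eq_iff in Hz.
  now rewrite (Pinj X Y f x z Hz).
- intros [Qclosed Qreflecting]; exists Qclosed.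
  apply atomic_sheaf_iff; split.
  + intros X Y c x x' Exx'; apply subpresheaf_eq_iff, (Pinj X Y c).
    exact (proj1 (subpresheaf_eq_iff Qclosed _ _) Exx').
  + intros X Y c [y Qy] Hy%invariant_subpresheaf.
    destruct (Pdesc X Y c y Hy) as [x Hx].
    assert (Qx : Q X x).
    { apply (Qreflecting X Y c); now rewrite <- Hx. }
    exists (exist _ x Qx); now apply subpresheaf_eq_iff.
Qed.

End Subsheaves.

Section CommonRestrictions.

Context {C : category} {P : presheaf C}.

Definition common_restr {X X' : C} (x : P X) (x' : P X') : Prop :=
  exists (Z : C) (u : hom Z X) (u' : hom Z X'), x ⋅ u = x' ⋅ u'.

Lemma common_restr_refl {X : C} (x : P X) : common_restr x x.
Proof. now exists X, (idm X), (idm X). Qed.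

Lemma common_restr_sym {X X' : C} (x : P X) (x' : P X') :
  common_restr x x' -> common_restr x' x.
Proof. intros [Z [u [u' E]]]; now exists Z, u', u. Qed.

Lemma common_restr_restr {X Y : C} (f : hom Y X) (x : P X) :
  common_restr (x ⋅ f) x.
Proof. exists Y, (idm Y), f; apply restr_id. Qed.

Lemma common_restr_reflect {X X' Y Y' : C} (f : hom Y X) (f' : hom Y' X')
    (x : P X) (x' : P X') :
  common_restr (x ⋅ f) (x' ⋅ f') -> common_restr x x'.
Proof.
intros [Z [u [u' E]]]; exists Z, (f ∘ u), (f' ∘ u').
now rewrite !restr_comp.
Qed.

Hypothesis C_coconfluent : coconfluent C.

Lemma common_restr_trans {X X' X'' : C} (x : P X) (x' : P X') (x'' : P X'') :
  common_restr x x' -> common_restr x' x'' -> common_restr x x''.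
Proof.
intros [Z [u [u' E]]] [W [v [v' F]]].
destruct (C_coconfluent _ _ _ u' v) as [V [a [b Hab]]].
exists V, (u ∘ a), (v' ∘ b).
now rewrite !restr_comp, E, <- F, <- !restr_comp, Hab.
Qed.

Lemma common_restr_map {X X' Y Y' : C} (f : hom Y X) (f' : hom Y' X')
    (x : P X) (x' : P X') :
  common_restr x x' -> common_restr (x ⋅ f) (x' ⋅ f').
Proof.
intros Hxx'.
apply common_restr_trans with (x' := x); [apply common_restr_restr|].
apply common_restr_trans with (x' := x'); [exact Hxx'|].
apply common_restr_sym, common_restr_restr.
Qed.

End CommonRestrictions.

Lemma sim_restr_closed {C : category} (P : presheaf C) :
  coconfluent C -> restr_closed (P := prod_presheaf P P) (sim P).
Proof. intros HC X Y f [x x']; exact (common_restr_map HC f f x x'). Qed.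

Lemma sim_restr_reflecting {C : category} (P : presheaf C) :
  restr_reflecting (P := prod_presheaf P P) (sim P).
Proof. intros X Y f [x x']; exact (common_restr_reflect f f x x'). Qed.

Lemma sim_equivalence {C : category} (P : presheaf C) (X : C) :
  coconfluent C -> Equivalence (fun x x' : P X => sim P X (x, x')).
Proof.
intros HC; split.
- exact common_restr_refl.
- exact common_restr_sym.
- exact (common_restr_trans HC).
Qed.

Theorem theorem5p1 (C : category) (HC : coconfluent C)
    (P : presheaf C) (HP : atomic_sheaf P) :
  (forall (X Y : C) (f : hom Y X) (x x' : P X),
     sim P X (x, x') -> sim P Y (x ⋅ f, x' ⋅ f)) /\
  (forall (X Y : C) (f : hom Y X) (x x' : P X),
     sim P Y (x ⋅ f, x' ⋅ f) -> sim P X (x, x')) /\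
  is_subsheaf (P := prod_presheaf P P) (sim P) /\
  (forall X : C, Equivalence (fun x x' : P X => sim P X (x, x'))).
Proof.
pose proof (sim_restr_closed P HC) as sim_closed.
pose proof (sim_restr_reflecting P) as sim_reflecting.
split; [|split; [|split]].
- intros X Y f x x'; exact (sim_closed X Y f (x, x')).
- intros X Y f x x'; exact (sim_reflecting X Y f (x, x')).
- apply is_subsheaf_iff; [now apply prod_atomic_sheaf | now split].
- intros X; now apply sim_equivalence.
Qed.
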